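(* Let $G$ be a finite simple graph with vertex set $V$, and let $V = U \sqcup W$ be any partition of the vertex set. Then $$s^+(G) \geq s^+(G[U]) + s^+(G[W]) \quad\text{and}\quad s^-(G) \geq s^-(G[U]) + s^-(G[W]).$$
   Context: For a finite simple graph $G$ with adjacency matrix $A_G$ having eigenvalues $\lambda_1 \geq \cdots \geq \lambda_n$, $s^+(G) = \sum_{i:\lambda_i \geq 0} \lambda_i^2$ and $s^-(G) = \sum_{i:\lambda_i \leq 0} \lambda_i^2$. $G[U]$ denotes the subgraph induced by $U$ (for $U=\emptyset$, the empty graph, with square energies $0$). *)

(* Defs.v *)
From HB Require Import structures.
From mathcomp Require Import all_boot all_order all_algebra.
From mathcomp Require Import polyorder polyrcf.
From mathcomp Require Import reals.

Set Implicit Arguments.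
Unset Strict Implicit.
Unset Printing Implicit Defensive.

Import Order.TTheory GRing.Theory Num.Theory.
Local Open Scope ring_scope.

(* Finite simple graphs; the graph with no vertex is allowed. *)
Record sgraph := SGraph {
  vertex :> finType;
  adj : rel vertex;
  adj_sym : symmetric adj;
  adj_irrefl : irreflexive adj }.

Section Induced.
Variables (G : sgraph) (U : {set G}).

Definition induced_adj : rel {x : G | x \in U} :=
  fun x y => adj (val x) (val y).

Lemma induced_adj_sym : symmetric induced_adj.
Proof. by move=> x y; apply: adj_sym. Qed.

Lemma induced_adj_irrefl : irreflexive induced_adj.
Proof. by move=> x; apply: adj_irrefl. Qed.

Definition induced : sgraph := SGraph induced_adj_sym induced_adj_irrefl.
End Induced.

(* The vertices are numbered by enum_val; the spectrum does not depend on it. *)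
Definition adjmx (R : pzRingType) (G : sgraph) : 'M[R]_#|G| :=
  \matrix_(i, j) (adj (enum_val i) (enum_val j))%:R.

(* The eigenvalues of A lying in R, in nonincreasing order, each repeated
   according to its algebraic multiplicity. For symmetric A this is the whole
   spectrum. *)
Definition eigenvalues (R : rcfType) n (A : 'M[R]_n) : seq R :=
  flatten [seq nseq (\mu_x (char_poly A)) x | x <- rev (rootsR (char_poly A))].

Lemma count_eigenvalues (R : rcfType) n (A : 'M[R]_n) (x : R) :
  count_mem x (eigenvalues A) = \mu_x (char_poly A).
Proof.
have p0 : char_poly A != 0 by exact: monic_neq0 (char_poly_monic A).
rewrite count_flatten -map_comp sumnE big_map.
rewrite (eq_bigr (fun y => if y == x then \mu_x (char_poly A) else 0%N));
  last first.
  by move=> y _ /=; rewrite count_nseq /=; case: eqP => [->|_]; rewrite ?mul1n.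
rewrite -big_mkcond /= big_const_seq iter_addn_0.
rewrite count_uniq_mem ?rev_uniq ?uniq_roots // mem_rev -roots_on_rootsR //=.
by case: (boolP (root _ x)) => [|/muNroot ->]; rewrite ?muln1 ?mul0n.
Qed.

Lemma mem_eigenvalues (R : rcfType) n (A : 'M[R]_n) (x : R) :
  (x \in eigenvalues A) = eigenvalue A x.
Proof.
rewrite eigenvalue_root_char -has_pred1 has_count count_eigenvalues mu_gt0 //.
exact: monic_neq0 (char_poly_monic A).
Qed.

Lemma sorted_eigenvalues (R : rcfType) n (A : 'M[R]_n) :
  sorted >=%O (eigenvalues A).
Proof.
rewrite /eigenvalues sorted_pairwise; last by move=> y x z /= xy yz; apply: le_trans yz xy.
have: pairwise >=%O (rev (rootsR (char_poly A))).
  rewrite -sorted_pairwise; last by move=> y x z /= xy yz; apply: le_trans yz xy.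
  by rewrite rev_sorted; apply: sub_sorted (sorted_roots _ _ _) => x y /ltW.
elim: (rev _) => //= y s IHs /andP[/allP hy /IHs {}IHs].
rewrite pairwise_cat IHs andbT; apply/andP; split.
  apply/allrelP => a b /nseqP[-> _] /flatten_mapP[z zs /nseqP[-> _]].
  exact: hy.
elim: (\mu_y _) => //= k ->; rewrite andbT.
by apply/allP => a /nseqP[-> _] /=.
Qed.

Definition pos_energy (R : rcfType) (G : sgraph) : R :=
  \sum_(x <- eigenvalues (adjmx R G) | 0 <= x) x ^+ 2.

Definition neg_energy (R : rcfType) (G : sgraph) : R :=
  \sum_(x <- eigenvalues (adjmx R G) | x <= 0) x ^+ 2.

(* Main.v *)
(* For a symmetric matrix A, s^+(A) is the minimum of ||A + N||_F^2 over the
   positive semidefinite matrices N: in an orthonormal eigenbasis of A the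
   diagonal of A + N is lambda_i + n_i with n_i >= 0, and the minimum is attained
   at the negative part of A. Take N optimal for A. Its blocks on U and W are
   positive semidefinite, and the squared Frobenius norms of the two diagonal
   blocks of A + N add up to at most that of A + N. For s^-, replace A + N by
   A - N. *)

Require Import Defs.
From mathcomp Require Import all_boot all_order all_algebra reals.
From mathcomp Require Import spectral sesquilinear polyorder complex.
Set Implicit Arguments.
Unset Strict Implicit.
Unset Printing Implicit Defensive.

Import Order.TTheory GRing.Theory Num.Theory.
Local Open Scope ring_scope.
Local Open Scope sesquilinear_scope.

Lemma sum_inj_le (R : numDomainType) (I J : finType) (f : I -> J) (H : J -> R) :
  injective f -> (forall j, 0 <= H j) -> \sum_i H (f i) <= \sum_j H j.
Proof.
move=> f_inj H_ge0; rewrite [leRHS](bigID [in [set f i | i in [set: I]]]) /=.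
rewrite big_imset; last by move=> i j _ _; apply: f_inj.
rewrite [X in X + _](eq_bigl xpredT) => [|i]; last by rewrite inE.
by rewrite lerDl sumr_ge0.
Qed.

Lemma char_poly_conj (F : fieldType) n (P A : 'M[F]_n) :
  P \in unitmx -> char_poly (invmx P *m A *m P) = char_poly A.
Proof.
move=> uP; rewrite /char_poly.
have -> : char_poly_mx (invmx P *m A *m P) =
    map_mx polyC (invmx P) *m char_poly_mx A *m map_mx polyC P.
  rewrite /char_poly_mx mulmxBr mulmxBl !map_mxM /= mul_mx_scalar -scalemxAl.
  by rewrite -(map_mxM _ (invmx P) P) mulVmx // map_mx1 scalemx1.
by rewrite !det_mulmx mulrAC -det_mulmx -map_mxM mulVmx // map_mx1 det1 mul1r.
Qed.

(** * Frobenius norms and positive semidefinite complex matrices *)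

Section ComplexMatrices.
Variable C : numClosedFieldType.

Definition sqnorm m n (M : 'M[C]_(m, n)) : C := \sum_i \sum_j `|M i j| ^+ 2.

(* Over the complex numbers, a matrix with nonnegative quadratic form is
   automatically Hermitian. *)
Definition psdmx n (N : 'M[C]_n) := forall v : 'rV_n, 0 <= (v *m N *m v^t*) 0 0.

Lemma sqnormE m n (M : 'M[C]_(m, n)) : sqnorm M = \tr (M *m M^t*).
Proof.
by apply: eq_bigr => i _; rewrite mxE; apply: eq_bigr => j _; rewrite !mxE normCK.
Qed.

Lemma conjTmx_mul m n p (A : 'M[C]_(m, n)) (B : 'M[C]_(n, p)) :
  (A *m B)^t* = B^t* *m A^t*.
Proof. by rewrite trmx_mul map_mxM. Qed.

Lemma sqnorm_unitary_conj n (P M : 'M[C]_n) :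
  P \is unitarymx -> sqnorm (P *m M *m P^t*) = sqnorm M.
Proof.
move=> uP; rewrite !sqnormE !conjTmx_mul trmxCK !mulmxA mulmxKtV //.
by rewrite mxtrace_mulC !mulmxA -[P^t*]mul1mx mulmxKtV // mul1mx.
Qed.

Lemma psdmx_conj m n (P : 'M[C]_(m, n)) (N : 'M[C]_n) :
  psdmx N -> psdmx (P *m N *m P^t*).
Proof.
by move=> psdN v; have := psdN (v *m P); rewrite conjTmx_mul !mulmxA.
Qed.

(** Extracting rows and columns along [f] is a congruence, by the matrix whose row [i] is row [f i]
    of the identity. *)
Lemma psdmx_mxsub m n (f : 'I_m -> 'I_n) (N : 'M[C]_n) :
  psdmx N -> psdmx (mxsub f f N).
Proof.
move=> /(psdmx_conj (rowsub f 1%:M)); congr psdmx.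
apply/matrixP => i j; rewrite mul_rowsub_mx mul1mx !mxE.
rewrite (bigD1 (f j)) //= !mxE eqxx rmorph1 mulr1 big1 ?addr0 // => k kfj.
by rewrite !mxE eq_sym (negPf kfj) rmorph0 mulr0.
Qed.

Lemma psdmx_diag n (N : 'M[C]_n) i : psdmx N -> 0 <= N i i.
Proof.
move=> /(_ (delta_mx 0 i)); rewrite -rowE mxE (bigD1 i) //= !mxE !eqxx rmorph1 mulr1.
by rewrite big1 ?addr0 // => k ki; rewrite !mxE (negPf ki) rmorph0 mulr0.
Qed.

Lemma psdmx_diag_mx n (d : 'rV[C]_n) :
  (forall i, 0 <= d 0 i) -> psdmx (diag_mx d).
Proof.
move=> d_ge0 v; rewrite mul_mx_diag mxE sumr_ge0 // => i _; rewrite !mxE.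
by rewrite mulrAC mulr_ge0 // mul_conjC_ge0.
Qed.

Lemma sqnorm_diag_mx n (d : 'rV[C]_n) : sqnorm (diag_mx d) = \sum_i `|d 0 i| ^+ 2.
Proof.
apply: eq_bigr => i _; rewrite (bigD1 i) //= mxE eqxx big1 ?addr0 // => j ji.
by rewrite mxE eq_sym (negPf ji) normr0 expr0n.
Qed.

Lemma sqnorm_diag_le n (M : 'M[C]_n) : \sum_i `|M i i| ^+ 2 <= sqnorm M.
Proof.
apply: ler_sum => i _; rewrite [leRHS](bigD1 i) //= lerDl sumr_ge0 // => j _.
exact: exprn_ge0.
Qed.

(** The maps [f] and [g] glue to an injection of the disjoint sum into the row indices. Nonnegative
    terms are dropped twice: whole rows outside its image, then the entries of each remaining row
    that lie outside the block. *)
Lemma sqnorm_mxsub_le n p q (f : 'I_p -> 'I_n) (g : 'I_q -> 'I_n) (M : 'M[C]_n) :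
    injective f -> injective g -> (forall i j, f i != g j) ->
  sqnorm (mxsub f f M) + sqnorm (mxsub g g M) <= sqnorm M.
Proof.
move=> f_inj g_inj fg.
pose h (x : 'I_p + 'I_q) := match x with inl i => f i | inr j => g j end.
have h_inj : injective h.
  move=> [i|i] [j|j] /=; first by move/f_inj->.
  - by move/eqP; rewrite (negPf (fg _ _)).
  - by move/esym/eqP; rewrite (negPf (fg _ _)).
  - by move/g_inj->.
pose H k := \sum_l `|M k l| ^+ 2.
have H_ge0 k : 0 <= H k by apply: sumr_ge0 => l _; apply: exprn_ge0.
apply: le_trans (sum_inj_le h_inj H_ge0); rewrite big_sumType /= lerD //.
all: apply: ler_sum => i _; under eq_bigr do rewrite mxE.
  by apply: (@sum_inj_le _ _ _ f (fun l => `|M (f i) l| ^+ 2)) => // j; apply: exprn_ge0.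
by apply: (@sum_inj_le _ _ _ g (fun l => `|M (g i) l| ^+ 2)) => // j; apply: exprn_ge0.
Qed.

End ComplexMatrices.

(** * Square energies of real symmetric matrices *)

Section SymmetricRealMatrices.
Variable R : rcfType.
Local Notation C := R[i].
Local Notation toC := (real_complex R).

Lemma eigenvalues_prod n (A : 'M[R]_n) (s : seq R) :
  char_poly A = \prod_(x <- s) ('X - x%:P) -> perm_eq (eigenvalues A) s.
Proof.
move=> cA; apply/allP => x _ /=; rewrite count_eigenvalues cA; apply/eqP.
elim: s {cA} => [|y s IHs]; first by rewrite big_nil (mu_polyC 1).
rewrite big_cons mu_mul ?IHs /=.
  by congr (_ + _)%N; have [->|/negPf yx] := eqVneq y x; 
     rewrite ?mu_XsubC // muNroot ?root_XsubC // eq_sym yx.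
by rewrite mulf_neq0 ?polyXsubC_eq0 ?monic_neq0 ?monic_prod_XsubC.
Qed.

(** The spectral theorem is applied over [C], where [A] becomes Hermitian, so the diagonalizing [P]
    is only complex unitary. This is why norms and semidefiniteness are set over [C]. *)
Lemma real_spectral n (A : 'M[R]_n) : A^T = A ->
  exists2 P : 'M[C]_n, P \is unitarymx & exists2 d : 'I_n -> R,
    P *m map_mx toC A *m P^t* = diag_mx (\row_i toC (d i)) &
    perm_eq (eigenvalues A) [seq d i | i : 'I_n].
Proof.
move=> Asym; set B := map_mx toC A.
have Breal : B \is a realmx.
  by apply/mxOverP => i j; rewrite mxE; apply/complex_realP; exists (A i j).
have Bherm : B \is hermsymmx.
  rewrite realsym_hermsym // is_hermitianmxE expr0 scale1r.
  by apply/eqP/matrixP => i j; rewrite !mxE -[in LHS]Asym mxE.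
pose P := spectralmx B; pose e := spectral_diag B.
have uP : P \is unitarymx := spectral_unitarymx B.
have /orthomx_spectralP BE : B \is normalmx := hermitian_normalmx Bherm.
have /mxOverP ereal := hermitian_spectral_diag_real Bherm.
(* Nothing is lost here: [ereal] says that the entries of [e] are real. *)
pose d i := complex.Re (e 0 i).
have eE : e = \row_i toC (d i).
  apply/rowP => i; rewrite mxE /d; have /complex_realP[x exE] := ereal 0 i.
  by rewrite /e exE.
exists P => //; exists d; first rewrite -eE.
  by rewrite BE -/P -/e invmx_unitary // !mulmxA (unitarymxP uP) mul1mx mulmxtVK.
apply: eigenvalues_prod; apply: (map_poly_inj toC).
rewrite map_char_poly -/B BE char_poly_conj ?unitarymx_unit // -/e eE.
rewrite char_poly_trig ?diag_mx_is_trig // rmorph_prod big_image /=.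
by apply: eq_bigr => i _; rewrite !mxE eqxx rmorphB /= map_polyX map_polyC.
Qed.

(* s^+ is the case s = 1 and s^- the case s = -1. *)
Definition signed_energy (s : R) n (A : 'M[R]_n) : R :=
  \sum_(x <- eigenvalues A | 0 <= s * x) x ^+ 2.

Lemma signed_energyE (s : R) n (A : 'M[R]_n) (d : 'I_n -> R) :
    perm_eq (eigenvalues A) [seq d i | i : 'I_n] ->
  toC (signed_energy s A) = \sum_i if 0 <= s * d i then toC (d i) ^+ 2 else 0.
Proof.
move=> eA; rewrite /signed_energy (perm_big _ eA) big_image_cond -big_mkcond /=.
by rewrite rmorph_sum; apply: eq_bigr => i _; rewrite rmorphXn.
Qed.

Lemma signed_energy_le (s : R) n (A : 'M[R]_n) (N : 'M[C]_n) :
    s ^+ 2 = 1 -> A^T = A -> psdmx N ->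
  toC (signed_energy s A) <= sqnorm (map_mx toC A + toC s *: N).
Proof.
move=> s2 /real_spectral[P uP [d PA eA]] psdN.
rewrite (signed_energyE _ eA) -(sqnorm_unitary_conj _ uP).
apply: le_trans (sqnorm_diag_le _); apply: ler_sum => i _.
case: ifP => [sd|_]; last exact: exprn_ge0.
rewrite mulmxDr mulmxDl PA -scalemxAr -scalemxAl.
move: (psdmx_diag i (psdmx_conj P psdN)); move: (P *m N *m P^t*) => Q Q_ge0.
rewrite !mxE eqxx mulr1n.
have s2C : toC s ^+ 2 = 1 by rewrite -rmorphXn /= s2.
have s1 : `|toC s| = 1.
  by apply/eqP; rewrite -sqrp_eq1 ?normr_ge0 // -normrX s2C normr1.
have sdC : 0 <= toC s * toC (d i) by rewrite -rmorphM (lecR 0).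
(* Multiplying by [s] inside the norm turns [d i + s q] into [s d i + q], with [q] the diagonal
   entry of [Q]. Both terms are nonnegative, so the square is at least [(s d i)^2 = (d i)^2]. *)
rewrite -[`|_|]mul1r -s1 -normrM mulrDr mulrA -expr2 s2C mul1r.
rewrite ger0_norm ?addr_ge0 // -[_ ^+ 2]mul1r -s2C -exprMn.
by rewrite ler_pXn2r ?nnegrE ?addr_ge0 // lerDl.
Qed.

Lemma signed_energy_attained (s : R) n (A : 'M[R]_n) :
    s ^+ 2 = 1 -> A^T = A -> exists2 N : 'M[C]_n, psdmx N &
  toC (signed_energy s A) = sqnorm (map_mx toC A + toC s *: N).
Proof.
move=> s2 /real_spectral[P uP [d PA eA]].
(* As [s ^+ 2 = 1], the sum [d i + s * c i] keeps the eigenvalues that the signed energy counts and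
   is zero at the others. *)
pose c i := if 0 <= s * d i then 0 else - (s * d i).
have c_ge0 i : 0 <= c i.
  by rewrite /c; case: ifP => // /negbT; rewrite -ltNge oppr_ge0 => /ltW.
pose D : 'M[C]_n := diag_mx (\row_i toC (c i)).
exists (P^t* *m D *m P).
  rewrite -{2}[P]trmxCK; apply/psdmx_conj/psdmx_diag_mx => i.
  by rewrite mxE (lecR 0).
rewrite (signed_energyE _ eA) -(sqnorm_unitary_conj _ uP).
rewrite mulmxDr mulmxDl PA -scalemxAr -scalemxAl !mulmxA (unitarymxP uP) mul1mx.
rewrite mulmxtVK //.
have -> : diag_mx (\row_i toC (d i)) + toC s *: D =
          diag_mx (\row_i toC (d i + s * c i)).
  by apply/matrixP => i j; rewrite !mxE rmorphD rmorphM mulrnAr -mulrnDl.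
rewrite sqnorm_diag_mx; apply: eq_bigr => i _.
rewrite mxE /c; case: ifP => _.
  rewrite mulr0 addr0 -normrX ger0_norm //.
  by rewrite -rmorphXn (lecR 0) sqr_ge0.
by rewrite mulrN mulrA -expr2 s2 mul1r subrr normr0 expr0n.
Qed.

Lemma signed_energy_superadditive (s : R) n p q (A : 'M[R]_n)
    (f : 'I_p -> 'I_n) (g : 'I_q -> 'I_n) :
    s ^+ 2 = 1 -> A^T = A ->
    injective f -> injective g -> (forall i j, f i != g j) ->
  signed_energy s (mxsub f f A) + signed_energy s (mxsub g g A) <=
  signed_energy s A.
Proof.
move=> s2 Asym f_inj g_inj fg.
have [N psdN AE] := signed_energy_attained s2 Asym.
rewrite -lecR AE rmorphD.
apply: le_trans (sqnorm_mxsub_le _ f_inj g_inj fg).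
have sub_le m (h : 'I_m -> 'I_n) : toC (signed_energy s (mxsub h h A)) <=
    sqnorm (mxsub h h (map_mx toC A + toC s *: N)).
  have -> : mxsub h h (map_mx toC A + toC s *: N) =
            map_mx toC (mxsub h h A) + toC s *: mxsub h h N.
    by apply/matrixP => i j; rewrite !mxE.
  by apply: signed_energy_le; rewrite ?trmx_mxsub ?Asym //; apply: psdmx_mxsub.
by apply: lerD; apply: sub_le.
Qed.

End SymmetricRealMatrices.

(** * Adjacency matrices of induced subgraphs *)

Lemma adjmx_sym (R : pzRingType) (G : sgraph) : (adjmx R G)^T = adjmx R G.
Proof. by apply/matrixP => i j; rewrite !mxE adj_sym. Qed.

(** The vertices of [U] need not be consecutive in the numbering of [G], so the submatrix is taken
    along an index map instead of as a contiguous block. *)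
Definition induced_index (G : sgraph) (U : {set G}) (i : 'I_#|induced U|) : 'I_#|G| :=
  enum_rank (val (enum_val i)).

Lemma induced_index_inj (G : sgraph) (U : {set G}) : injective (@induced_index G U).
Proof. by move=> i j /enum_rank_inj/val_inj/enum_val_inj. Qed.

Lemma adjmx_induced (R : pzRingType) (G : sgraph) (U : {set G}) :
  adjmx R (induced U) = mxsub (@induced_index G U) (@induced_index G U) (adjmx R G).
Proof. by apply/matrixP => i j; rewrite !mxE !enum_rankK. Qed.

Unset Implicit Arguments.

Theorem theorem1p6 (R : realType) (G : sgraph) (U W : {set G})
    (UW_cover : U :|: W = [set: G]) (UW_disjoint : U :&: W = set0) :
  pos_energy R G >= pos_energy R (induced U) + pos_energy R (induced W) /\
  neg_energy R G >= neg_energy R (induced U) + neg_energy R (induced W).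
Proof.
have super (s : R) : s ^+ 2 = 1 ->
    signed_energy s (adjmx R (induced U)) +
    signed_energy s (adjmx R (induced W)) <=
    signed_energy s (adjmx R G).
  move=> s2; rewrite !adjmx_induced.
  apply: signed_energy_superadditive; rewrite ?adjmx_sym //.
  1,2: exact: induced_index_inj.
  (* An index common to both maps would give a vertex in [U] and in [W]. *)
  move=> i j; apply/eqP => /enum_rank_inj ij.
  have : val (enum_val i) \in U :&: W.
    by rewrite inE (valP (enum_val i)) ij (valP (enum_val j)).
  by rewrite UW_disjoint inE.
have posE H : pos_energy R H = signed_energy 1 (adjmx R H).
  by apply: eq_bigl => x; rewrite mul1r.
have negE H : neg_energy R H = signed_energy (-1) (adjmx R H).
  by apply: eq_bigl => x; rewrite mulN1r oppr_ge0.
by rewrite !posE !negE; split; apply: super; rewrite ?sqrrN expr1n.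
Qed.
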